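(* Let $H\in\mathbb{N}$, $\alpha\in\mathbb{R}$, and let $\mathcal{L}_\infty$, $\mathcal{G}$, $V$ be as in the context. Let $T\in(0,\infty)$ and let $\Theta\in C([0,T],\mathbb{R}^{3H+1})$ satisfy for all $t\in[0,T]$ that $\Theta_t=\Theta_0-\int_0^t\mathcal{G}(\Theta_s)\,ds$. Then for all $t\in[0,T]$ it holds that $$V(\Theta_t)=V(\Theta_0)-8\int_0^t\mathcal{L}_\infty(\Theta_s)\,ds.$$
   Context: $\mathbb{N}=\{1,2,\dots\}$. Fix $H\in\mathbb{N}$, $\alpha\in\mathbb{R}$. For $r\in[1,\infty)$, $x\in\mathbb{R}$ let $\sigma_r(x)=r^{-1}\ln(1+r^{-1}e^{rx})$, and let $\sigma_\infty(x)=\max\{x,0\}$. For $r\in[1,\infty]$, $\phi=(\phi_1,\dots,\phi_{3H+1})\in\mathbb{R}^{3H+1}$, $x\in\mathbb{R}$ let $\mathscr{N}_r^{\phi}(x)=\phi_{3H+1}+\sum_{j=1}^{H}\phi_{2H+j}\,\sigma_r(\phi_jx+\phi_{H+j})$ and $\mathcal{L}_r(\phi)=\int_0^1(\mathscr{N}_r^{\phi}(y)-\alpha)^2\,dy$. The function $\mathcal{G}\colon\mathbb{R}^{3H+1}\to\mathbb{R}^{3H+1}$ satisfies $\mathcal{G}(\phi)=\lim_{r\to\infty}(\nabla\mathcal{L}_r)(\phi)$ for every $\phi$ for which the sequence $((\nabla\mathcal{L}_r)(\phi))_{r\in\mathbb{N}}$ converges. $\|\cdot\|$ is the Euclidean norm.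 $V\colon\mathbb{R}^{3H+1}\to\mathbb{R}$ is given by $V(\phi)=\|\phi\|^2+(\phi_{3H+1}-2\alpha)^2$. *)

(* Defs.v *)
From HB Require Import structures.
From mathcomp Require Import all_boot all_order all_algebra.
From mathcomp Require Import all_classical all_reals all_analysis.
Import Order.TTheory GRing.Theory Num.Theory.
Import numFieldNormedType.Exports.

Set Implicit Arguments.
Unset Strict Implicit.
Unset Printing Implicit Defensive.

Local Open Scope classical_set_scope.
Local Open Scope ring_scope.

(* The parameter r ranges over [1, +oo]; the value at -oo is irrelevant. *)
Definition sigma (R : realType) (r : \bar R) (x : R) : R :=
  match r with
  | r'%:E => r'^-1 * ln (1 + r'^-1 * expR (r' * x))
  | +oo%E => Num.max x 0
  | -oo%E => 0
  end.

(* A parameter vector (phi_1, ..., phi_{3H+1}) is a row vector whose entries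
   are indexed from 0, so that for j < H the inner weight, the inner bias and
   the outer weight of the j-th neuron have indices j, H + j and 2H + j, and
   the outer bias has index 3H, the last one. *)
Definition network (R : realType) (H : nat) (r : \bar R)
    (phi : 'rV[R]_(3 * H).+1) (x : R) : R :=
  phi 0 ord_max +
  \sum_(j < H) phi 0 (inord (2 * H + j)) *
    sigma r (phi 0 (inord j) * x + phi 0 (inord (H + j))).

Definition risk (R : realType) (H : nat) (alpha : R) (r : \bar R)
    (phi : 'rV[R]_(3 * H).+1) : R :=
  \int[lebesgue_measure]_(y in `[0, 1]) (network r phi y - alpha) ^+ 2.

Definition gradient (R : realType) (n : nat) (f : 'rV[R]_n.+1 -> R)
    (phi : 'rV[R]_n.+1) : 'rV[R]_n.+1 :=
  \row_i 'D_(delta_mx 0 i) f phi.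

(* The sequence is indexed by r = 1, 2, ..., hence the shift. Nothing is
   required of calG where the sequence of gradients diverges. *)
Definition limit_gradient (R : realType) (H : nat) (alpha : R)
    (calG : 'rV[R]_(3 * H).+1 -> 'rV[R]_(3 * H).+1) : Prop :=
  forall phi : 'rV[R]_(3 * H).+1,
    cvgn (fun r : nat => gradient (risk alpha (r.+1%:R)%:E) phi) ->
    calG phi = limn (fun r : nat => gradient (risk alpha (r.+1%:R)%:E) phi).

(* The library norm on matrices is the max norm, not the Euclidean one. *)
Definition euclidean_norm (R : realType) (n : nat) (v : 'rV[R]_n) : R :=
  Num.sqrt (\sum_i v 0 i ^+ 2).

Definition lyapunov (R : realType) (H : nat) (alpha : R)
    (phi : 'rV[R]_(3 * H).+1) : R :=
  euclidean_norm phi ^+ 2 + (phi 0 ord_max - 2 * alpha) ^+ 2.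

(* Entrywise Lebesgue integral of a vector-valued function. *)
Definition row_integral (R : realType) (n : nat) (D : set R)
    (f : R -> 'rV[R]_n) : 'rV[R]_n :=
  \row_i \int[lebesgue_measure]_(s in D) f s 0 i.

(* Main.v *)
(* For finite r the gradient of the risk is computed under the integral sign.
   As r tends to infinity the derivatives of sigma_r converge boundedly and
   pointwise to the indicator of ]0, +oo[, so by dominated convergence the
   gradients converge at every phi, which determines G everywhere. In this limit
   <grad V, G> = 8 L_oo by the homogeneity of the ReLU. Since G is
   discontinuous, t |-> V(Theta_t) need not be differentiable a priori; but each
   coordinate is the primitive of a bounded function, hence
   (Theta_t - p)^2 + 2 int_0^t (Theta_s - p) G(Theta_s) ds has increments
   O((t - s)^2), so it is constant. *)

Require Import Defs.
From HB Require Import structures.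
From mathcomp Require Import all_boot all_order all_algebra.
From mathcomp Require Import all_classical all_reals all_analysis.
From mathcomp Require Import measurable_realfun zify ring lra.
Import Order.TTheory GRing.Theory Num.Theory.
Import numFieldNormedType.Exports.

Set Implicit Arguments.
Unset Strict Implicit.
Unset Printing Implicit Defensive.

Local Open Scope classical_set_scope.
Local Open Scope ring_scope.

(** * Activations and their derivatives: uniform bounds, measurability, limits as [r] tends to
    infinity *)

(* At the kink of the ReLU the value is 0, the limit of 1 / (r + 1). *)
Definition dsigma (R : realType) (r : \bar R) (x : R) : R :=
  match r with
  | r'%:E => expR (r' * x) / (r' + expR (r' * x))
  | +oo%E => (0 < x)%R%:R
  | -oo%E => 0
  end.

(** The bound does not depend on [r], so it provides the dominating constants for all later
    limits. *)
Lemma sigma_bound (R : realType) (r : \bar R) (x : R) :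
  (1 <= r)%E -> `|sigma r x| <= `|x| + 1.
Proof.
case: r => [r| |] //=; last first.
  move=> _; case: (leP x 0) => h; rewrite ?normr0 ?addr_ge0//.
  by rewrite gtr0_norm//; lra.
rewrite lee_fin => r1; have r0 : 0 < r by lra.
have e0 := expR_gt0 (r * x).
have q1 : r^-1 <= 1 by rewrite invf_le1.
have q0 : 0 < r^-1 by rewrite invr_gt0.
have a1 : 1 <= 1 + r^-1 * expR (r * x) by rewrite lerDl mulr_ge0 ?ltW.
rewrite ger0_norm; last by rewrite mulr_ge0 ?ln_ge0// ltW.
rewrite mulrC ler_pdivrMr//.
have h : 1 + r^-1 * expR (r * x) <= expR (r * (`|x| + 1)).
  rewrite mulrDr mulr1 expRD.
  have e1 : expR (r * x) <= expR (r * `|x|).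
    by rewrite ler_expR ler_pM2l// ler_norm.
  have e2 : 1 <= expR (r * `|x|) by rewrite -expR0 ler_expR mulr_ge0// ltW.
  have e3 := expR_ge1Dx r.
  have : r^-1 * expR (r * x) <= expR (r * `|x|).
    by rewrite -[leRHS]mul1r; apply: ler_pM => //; exact: ltW.
  nra.
rewrite (mulrC _ r) -[leRHS]expRK ler_ln ?posrE ?expR_gt0//.
exact: lt_le_trans a1.
Qed.

Lemma dsigma_bound (R : realType) (r : \bar R) (x : R) :
  (1 <= r)%E -> `|dsigma r x| <= 1.
Proof.
case: r => [r| |] //=; last by case: (0 < x); rewrite ?normr1 ?normr0.
rewrite lee_fin => r1; have e0 := expR_gt0 (r * x).
rewrite ger0_norm; last by rewrite divr_ge0; lra.
by rewrite ler_pdivrMr; lra.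
Qed.

Lemma is_derive_sigma (R : realType) (r x : R) : 0 < r ->
  is_derive x 1 (sigma r%:E) (dsigma r%:E x).
Proof.
move=> r0; have e0 := expR_gt0 (r * x).
have q0 : 0 < r^-1 by rewrite invr_gt0.
have h0 : 0 < 1 + r^-1 * expR (r * x) by rewrite addr_gt0// mulr_gt0.
have dl : is_derive (1 + r^-1 * expR (r * x)) 1 (@ln R)
    (1 + r^-1 * expR (r * x))^-1 by exact: is_derive1_ln.
have dM : is_derive x 1 (fun x : R => r * x) r.
  apply: is_derive_eq.
  by rewrite /GRing.scale/=; ring.
have dE : is_derive x 1 (fun x : R => expR (r * x)) (expR (r * x) * r).
  by apply: is_derive1_comp.
have dP : is_derive x 1 (fun x : R => 1 + r^-1 * expR (r * x)) (expR (r * x)).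
  apply: is_derive_eq.
  by rewrite /GRing.scale/=; field; rewrite gt_eqF.
have dL : is_derive x 1 (fun x : R => ln (1 + r^-1 * expR (r * x)))
   ((1 + r^-1 * expR (r * x))^-1 * expR (r * x)).
  by apply: (@is_derive1_comp _ (@ln R) (fun x : R => 1 + r^-1 * expR (r * x))).
rewrite /sigma; apply: is_derive_eq.
rewrite /GRing.scale/=; field.
by apply/andP; split; apply: lt0r_neq0 => //; lra.
Qed.

Lemma continuous_sigma (R : realType) (r : R) : 0 < r ->
  continuous (sigma r%:E).
Proof.
move=> r0 x; apply: differentiable_continuous; apply/derivable1_diffP.
by have [] := is_derive_sigma x r0.
Qed.

Lemma measurable_sigma (R : realType) (r : \bar R) : (1 <= r)%E ->
  measurable_fun [set: R] (sigma r).
Proof.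
case: r => [r| |] //=.
  rewrite lee_fin => r1; apply: continuous_measurable_fun.
  by apply: continuous_sigma; lra.
move=> _; exact: measurable_maxr.
Qed.

Lemma measurable_dsigma (R : realType) (r : \bar R) : (1 <= r)%E ->
  measurable_fun [set: R] (dsigma r).
Proof.
case: r => [r| |] //=.
  rewrite lee_fin => r1; apply: continuous_measurable_fun => x.
  have e0 := expR_gt0 (r * x).
  have cE : {for x, continuous (fun x : R => expR (r * x))}.
    apply: (@continuous_comp _ _ _ (fun x => r * x) (@expR R)).
      exact: mulrl_continuous.
    exact: continuous_expR.
  apply: cvgM => //; apply: cvgV; first by rewrite gt_eqF//; lra.
  by apply: cvgD => //; exact: cvg_cst.
move=> _; rewrite (_ : dsigma _ = fun x => if 0 < x then 1 else 0).
  by apply: measurable_fun_ifT => //; exact: measurable_fun_ltr.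
by apply/funext => x; rewrite /dsigma; case: (0 < x).
Qed.

(** Since [ln m] is twice [ln (Num.sqrt m)], it is at most [2 * Num.sqrt m]; dividing by [m] leaves
    a multiple of the root of a harmonic sequence. *)
Lemma cvg_lnV_natr (R : realType) :
  (fun n => (n.+1%:R)^-1 * ln (n.+1%:R) : R) @ \oo --> (0 : R).
Proof.
have sqrtV : (fun n => Num.sqrt ((n.+1%:R)^-1) : R) @ \oo --> (0 : R).
  rewrite -(@sqrtr0 R).
  exact: (cvg_comp _ _ (@cvg_harmonic R) (@sqrt_continuous R 0)).
have sqrtV2 : (fun n => 2 * Num.sqrt ((n.+1%:R)^-1) : R) @ \oo --> (0 : R).
  by rewrite -(mulr0 2); apply: cvgM => //; exact: cvg_cst.
apply: (squeeze_cvgr _ (cvg_cst 0) sqrtV2); apply: nearW => n /=.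
have n1 : 1 <= n.+1%:R :> R by rewrite ler1n.
have n0 : 0 < n.+1%:R :> R by rewrite ltr0n.
rewrite mulr_ge0 ?ln_ge0 ?invr_ge0//=.
move: (n.+1%:R) n0 n1 => m n0 n1.
have s0 : 0 < Num.sqrt m by rewrite sqrtr_gt0.
have sE : m = Num.sqrt m ^+ 2 by rewrite sqr_sqrtr// ltW.
rewrite sqrtrV; last exact: ltW.
have hl : ln m <= 2 * Num.sqrt m.
  by rewrite {1}sE lnXn// mulr2n; have := ln_sublinear s0; lra.
have -> : m^-1 = (Num.sqrt m)^-1 * (Num.sqrt m)^-1 by rewrite {1}sE expr2 invfM.
rewrite -mulrA mulrC ler_pM2r ?invr_gt0//.
by rewrite ler_pdivrMl// mulrC.
Qed.

(* The error is [ln r / r] for positive inputs: factor [e^(rx)] out of the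
   logarithm. *)
Lemma cvg_sigma (R : realType) (x : R) :
  (fun n => sigma (n.+1%:R)%:E x) @ \oo --> sigma +oo%E x.
Proof.
have [x0|x0] := leP x 0.
  rewrite /sigma; have -> : Num.max x 0 = 0 by apply/max_idPr.
  apply: (squeeze_cvgr _ (cvg_cst 0) (@cvg_harmonic R)); apply: nearW => n /=.
  have n1 : 1 <= n.+1%:R :> R by rewrite ler1n.
  have n0 : 0 < n.+1%:R :> R by rewrite ltr0n.
  move: (n.+1%:R) n0 n1 => m n0 n1.
  have q1 : m^-1 <= 1 by rewrite invf_le1.
  have q0 : 0 < m^-1 by rewrite invr_gt0.
  have e0 := expR_gt0 (m * x).
  have e1 : expR (m * x) <= 1 by rewrite expR_le1; nra.
  have a0 : 0 <= m^-1 * expR (m * x) by rewrite mulr_ge0 ?ltW.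
  have l0 : 0 <= ln (1 + m^-1 * expR (m * x)) by apply: ln_ge0; rewrite lerDl.
  apply/andP; split; first by apply: mulr_ge0 => //; exact: ltW.
  have a1 : -1 < m^-1 * expR (m * x) by apply: lt_le_trans a0; lra.
  have := le_ln1Dx a1; nra.
rewrite /sigma; have -> : Num.max x 0 = x by apply/max_idPl; exact: ltW.
(* Once the exponential is factored out, the value is [x + m^-1 * ln (m^-1 + expR (- (m * x)))].
   Dropping the exponential inside the logarithm gives [lo]; bounding that logarithm by 1 gives
   [hi]. *)
have lo : (fun n => x - (n.+1%:R)^-1 * ln (n.+1%:R) : R) @ \oo --> x.
  rewrite -[X in _ --> X]subr0; apply: cvgB; first exact: cvg_cst.
  exact: cvg_lnV_natr.
have hi : (fun n => x + (n.+1%:R)^-1 : R) @ \oo --> x.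
  rewrite -[X in _ --> X]addr0; apply: cvgD; first exact: cvg_cst.
  exact: cvg_harmonic.
apply: (squeeze_cvgr _ lo hi); apply: nearW => n /=.
have n1 : 1 <= n.+1%:R :> R by rewrite ler1n.
have n0 : 0 < n.+1%:R :> R by rewrite ltr0n.
move: (n.+1%:R) n0 n1 => m n0 n1.
have q1 : m^-1 <= 1 by rewrite invf_le1.
have q0 : 0 < m^-1 by rewrite invr_gt0.
have e0 := expR_gt0 (- (m * x)).
have e1 : expR (- (m * x)) <= 1 by rewrite expR_le1; nra.
have -> : 1 + m^-1 * expR (m * x) =
    expR (m * x) * (m^-1 + expR (- (m * x))).
  by rewrite mulrDr expRxMexpNx_1; ring.
rewrite lnM ?posrE ?expR_gt0 ?addr_gt0// expRK mulrDr mulrA mulVf ?gt_eqF//.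
rewrite mul1r; apply/andP; split.
  rewrite lerD2l -mulrN ler_pM2l// -lnV ?posrE// ler_ln ?posrE ?addr_gt0//.
  by rewrite lerDl ltW.
rewrite lerD2l -[leRHS]mulr1 ler_pM2l//.
have a1 : -1 < m^-1 + expR (- (m * x)) - 1 by lra.
have h := le_ln1Dx a1.
rewrite [X in ln X](_ : _ = 1 + (m^-1 + expR (- (m * x)) - 1)); last by ring.
lra.
Qed.

(** For [x <= 0] the numerator is at most 1 and the denominator at least [r]. For [0 < x] the
    distance to 1 is [r / (r + expR (r * x))], which is O(1/r) because the exponential dominates
    [(r * x) ^+ 2 / 2]. *)
Lemma cvg_dsigma (R : realType) (x : R) :
  (fun n => dsigma (n.+1%:R)%:E x) @ \oo --> dsigma +oo%E x.
Proof.
rewrite /dsigma; have [x0|x0] := ltP 0 x; last first.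
  apply: (squeeze_cvgr _ (cvg_cst 0) (@cvg_harmonic R)); apply: nearW => n /=.
  have n0 : 0 < n.+1%:R :> R by rewrite ltr0n.
  move: (n.+1%:R) n0 => m n0.
  have e0 := expR_gt0 (m * x).
  have e1 : expR (m * x) <= 1 by rewrite expR_le1; nra.
  rewrite divr_ge0 /=; [|lra|lra].
  rewrite ler_pdivrMr; last by lra.
  rewrite mulrDr mulVf ?gt_eqF//.
  by rewrite (le_trans e1)// lerDl mulr_ge0 ?invr_ge0; lra.
have lo : (fun n => 1 - 2 / x ^+ 2 * (n.+1%:R)^-1 : R) @ \oo --> (1 : R).
  rewrite -[X in _ --> X]subr0 -(mulr0 (2 / x ^+ 2)).
  apply: cvgB; first exact: cvg_cst.
  by apply: cvgM; [exact: cvg_cst|exact: cvg_harmonic].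
apply: (squeeze_cvgr _ lo (cvg_cst (1 : R))); apply: nearW => n /=.
have n0 : 0 < n.+1%:R :> R by rewrite ltr0n.
move: (n.+1%:R) n0 => m n0.
have e0 := expR_gt0 (m * x).
have e1 : (m * x) ^+ 2 / 2 <= expR (m * x).
  have := @expR_ge1Dxn R (m * x) 1%N ltac:(nra).
  by rewrite (_ : 2`! = 2)//; lra.
apply/andP; split; last by rewrite ler_pdivrMr; lra.
have -> : expR (m * x) / (m + expR (m * x)) = 1 - m / (m + expR (m * x)).
  by field; apply: lt0r_neq0; lra.
rewrite lerD2l lerN2 ler_pdivrMr; last by lra.
have -> : 2 / x ^+ 2 / m * (m + expR (m * x)) =
    2 / x ^+ 2 + m * (expR (m * x) / ((m * x) ^+ 2 / 2)).
  by field; rewrite !gt_eqF.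
have : 1 <= expR (m * x) / ((m * x) ^+ 2 / 2).
  by rewrite ler_pdivlMr ?mul1r// divr_gt0// exprn_gt0// mulr_gt0.
have : 0 < 2 / x ^+ 2 by rewrite divr_gt0// exprn_gt0.
nra.
Qed.

(** * Directional derivatives of network and risk, with bounds uniform in [r] *)

Definition preact (R : realType) (H : nat) (phi : 'rV[R]_(3 * H).+1)
    (j : 'I_H) (y : R) : R :=
  phi 0 (inord j) * y + phi 0 (inord (H + j)).

(** Product and chain rule in direction [v]; [preact] is linear in the parameters, so its own
    derivative is [preact v]. At [r = +oo] the formula is only formal, since the ReLU has a kink. *)
Definition dnetwork (R : realType) (H : nat) (r : \bar R)
    (phi v : 'rV[R]_(3 * H).+1) (y : R) : R :=
  v 0 ord_max +
  \sum_(j < H) (v 0 (inord (2 * H + j)) * sigma r (preact phi j y) +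
    phi 0 (inord (2 * H + j)) * (dsigma r (preact phi j y) * preact v j y)).

Definition drisk_integrand (R : realType) (H : nat) (alpha : R) (r : \bar R)
    (phi v : 'rV[R]_(3 * H).+1) (y : R) : R :=
  2 * (network r phi y - alpha) * dnetwork r phi v y.

Definition drisk (R : realType) (H : nat) (alpha : R) (r : \bar R)
    (phi v : 'rV[R]_(3 * H).+1) : R :=
  \int[lebesgue_measure]_(y in `[0, 1]) drisk_integrand alpha r phi v y.

Lemma normr_sum_le_const (R : realType) (n : nat) (F : 'I_n -> R) (B : R) :
  (forall j, `|F j| <= B) -> `|\sum_(j < n) F j| <= n%:R * B.
Proof.
move=> FB; apply: le_trans (ler_norm_sum _ _ _) _.
apply: le_trans (ler_sum _ (fun j _ => FB j)) _.
by rewrite sumr_const card_ord mulr_natl.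
Qed.

Section Bounds.
Variables (R : realType) (H : nat) (r : \bar R) (r1 : (1 <= r)%E).
Implicit Types phi v : 'rV[R]_(3 * H).+1.

Lemma preact_bound phi j (K y : R) : (forall i, `|phi 0 i| <= K) ->
  0 <= y <= 1 -> `|preact phi j y| <= 2 * K.
Proof.
move=> pK /andP[y0 y1]; apply: le_trans (ler_normD _ _) _.
rewrite mulr2n mulrDl mul1r; apply: lerD => //.
by rewrite normrM -[K]mulr1 ler_pM// ger0_norm.
Qed.

Lemma network_bound phi (K y : R) : (forall i, `|phi 0 i| <= K) ->
  0 <= y <= 1 -> `|network r phi y| <= K + H%:R * (K * (2 * K + 1)).
Proof.
move=> pK y01; apply: le_trans (ler_normD _ _) _; apply: lerD => //.
apply: normr_sum_le_const => j; rewrite normrM ler_pM//.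
apply: le_trans (sigma_bound _ r1) _; rewrite lerD2r.
exact: (preact_bound j pK y01).
Qed.

Lemma dnetwork_bound phi v (K L y : R) : (forall i, `|phi 0 i| <= K) ->
  (forall i, `|v 0 i| <= L) -> 0 <= y <= 1 ->
  `|dnetwork r phi v y| <= L + H%:R * (L * (2 * K + 1) + K * (2 * L)).
Proof.
move=> pK vL y01; apply: le_trans (ler_normD _ _) _; apply: lerD => //.
apply: normr_sum_le_const => j.
apply: le_trans (ler_normD _ _) _; apply: lerD; rewrite normrM ler_pM//.
  by apply: le_trans (sigma_bound _ r1) _; rewrite lerD2r preact_bound.
rewrite normrM -[leRHS]mul1r ler_pM//; first exact: dsigma_bound.
exact: preact_bound.
Qed.

End Bounds.

(** [B] is chosen before [r], [phi], [v] and [y]: one constant dominates along a line of parameters,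
    along the sequence in [r], and along a bounded trajectory. *)
Lemma drisk_integrand_bound (R : realType) (H : nat) (alpha K L : R) :
  exists B : R, forall (r : \bar R) (phi v : 'rV[R]_(3 * H).+1) (y : R),
    (1 <= r)%E -> (forall i, `|phi 0 i| <= K) ->
    (forall i, `|v 0 i| <= L) -> 0 <= y <= 1 ->
    `|drisk_integrand alpha r phi v y| <= B.
Proof.
exists (2 * (K + H%:R * (K * (2 * K + 1)) + `|alpha|) *
  (L + H%:R * (L * (2 * K + 1) + K * (2 * L)))) => r phi v y r1 pK vL y01.
rewrite /drisk_integrand normrM; apply: ler_pM => //; last first.
  exact: dnetwork_bound.
rewrite normrM ger0_norm// ler_pM2l//.
by apply: le_trans (ler_normB _ _) _; rewrite lerD2r network_bound.
Qed.

(** * Joint measurability in the parameters and the input *)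

Section Measurability.
Context (R : realType) (H : nat) d (X : measurableType d).
Variables (r : \bar R) (r1 : (1 <= r)%E).
Variables (phi : X -> 'rV[R]_(3 * H).+1) (y : X -> R).
Hypothesis mphi : forall i, measurable_fun setT (fun x => phi x 0 i).
Hypothesis my : measurable_fun setT y.

Lemma measurable_preact j :
  measurable_fun setT (fun x => preact (phi x) j (y x)).
Proof. by apply: measurable_funD => //; exact: measurable_funM. Qed.

Lemma measurable_network :
  measurable_fun setT (fun x => network r (phi x) (y x)).
Proof.
apply: measurable_funD => //; apply: measurable_sum => j.
apply: measurable_funM => //.
apply: measurableT_comp; first exact: measurable_sigma.
exact: measurable_preact.
Qed.

Lemma measurable_drisk_integrand alpha v :
  measurable_fun setT (fun x => drisk_integrand alpha r (phi x) v (y x)).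
Proof.
apply: measurable_funM.
  apply: measurable_funM => //; apply: measurable_funB => //.
  exact: measurable_network.
apply: measurable_funD => //; apply: measurable_sum => j.
have mp := measurable_preact j.
apply: measurable_funD; apply: measurable_funM => //.
  by apply: measurableT_comp => //; exact: measurable_sigma.
apply: measurable_funM.
  by apply: measurableT_comp => //; exact: measurable_dsigma.
by apply: measurable_funD => //; exact: measurable_funM.
Qed.

End Measurability.

(** * Differentiation of the risk under the integral sign for finite [r] *)

Lemma integrable_itv_bounded (R : realType) (a b B : R) (f : R -> R) :
  measurable_fun `[a, b] f -> (forall x, a <= x <= b -> `|f x| <= B) ->
  (@lebesgue_measure R).-integrable `[a, b] (EFin \o f).
Proof.
move=> mf fB; apply: measurable_bounded_integrable => //.
  by rewrite /= lebesgue_measure_itv/=; case: ifP => _; rewrite ltry.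
exists B; split; first exact: num_real.
by move=> M BM x /=; rewrite in_itv/= => /fB h; apply: le_trans h (ltW BM).
Qed.

Lemma normr_coord_le (R : realType) (m n : nat) (M : 'M[R]_(m.+1, n.+1)) i j :
  `|M i j| <= `|M|.
Proof.
rewrite [leRHS]mx_normrE.
exact: (le_bigmax _ (fun ij : 'I_m.+1 * 'I_n.+1 => `|M ij.1 ij.2|) (i, j)).
Qed.

Lemma preact_line (R : realType) (H : nat) (phi v : 'rV[R]_(3 * H).+1) j
    (h y : R) :
  preact (h *: v + phi) j y = h * preact v j y + preact phi j y.
Proof. by rewrite /preact !mxE; ring. Qed.

Lemma is_derive_network (R : realType) (H : nat) (r : R)
    (phi v : 'rV[R]_(3 * H).+1) (h y : R) : 0 < r ->
  is_derive h 1 (fun h : R => network r%:E (h *: v + phi) y)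
    (dnetwork r%:E (h *: v + phi) v y).
Proof.
move=> r0.
have dA (a b : R) : is_derive h 1 (fun h : R => h * a + b) a.
  by apply: is_derive_eq; rewrite /GRing.scale/=; ring.
have dS (j : 'I_H) : is_derive h 1
    (fun h : R => sigma r%:E (preact (h *: v + phi) j y))
    (dsigma r%:E (preact (h *: v + phi) j y) * preact v j y).
  under [X in is_derive _ _ X]eq_fun do rewrite preact_line.
  rewrite preact_line.
  have ds := is_derive_sigma (h * preact v j y + preact phi j y) r0.
  exact: (@is_derive1_comp _ (sigma r%:E)
    (fun h => h * preact v j y + preact phi j y)).
have dO i : is_derive h 1 (fun h : R => (h *: v + phi) 0 i) (v 0 i).
  by under [X in is_derive _ _ X]eq_fun do rewrite !mxE.
(* The network is recast as a sum of functions, the shape to which the derivative rules for sums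
   apply. *)
rewrite (_ : (fun h => _) = (fun h : R => (h *: v + phi) 0 ord_max) +
    \sum_(j < H) (fun h : R => (h *: v + phi) 0 (inord (2 * H + j)) *
      sigma r%:E (preact (h *: v + phi) j y))); last first.
  by apply/funext => x; rewrite /network fctE fct_sumE.
apply: is_deriveD.
apply: is_derive_sum => j.
apply: is_derive_eq.
by rewrite /GRing.scale/=; ring.
Qed.

(** The directional derivative is the derivative at [h = 0] of the risk along the line
    [h *: v + phi], so the one-parameter theorem on []-1, 1[] suffices, with a constant as
    dominating function. *)
Lemma derive_risk (R : realType) (H : nat) (alpha r : R)
    (phi v : 'rV[R]_(3 * H).+1) : 1 <= r ->
  'D_v (risk alpha r%:E) phi = drisk alpha r%:E phi v.
Proof.
move=> r1; have r0 : 0 < r by lra.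
have r1E : (1 <= r%:E)%E by rewrite lee_fin.
(* Bounds every coordinate of [h *: v + phi] as long as [h] stays in []-1, 1[]. *)
pose K := `|phi| + `|v|.
pose f (h y : R) := (network r%:E (h *: v + phi) y - alpha) ^+ 2.
have line_le (h : R) : -1 < h < 1 -> forall i, `|(h *: v + phi) 0 i| <= K.
  move=> h1 i; rewrite !mxE; apply: le_trans (ler_normD _ _) _.
  rewrite /K addrC lerD ?normr_coord_le// normrM.
  rewrite -[leRHS]mul1r ler_pM ?normr_coord_le//.
  by rewrite ler_norml; lra.
have df (h y : R) : is_derive h 1 (f ^~ y)
    (drisk_integrand alpha r%:E (h *: v + phi) v y).
  have dN := is_derive_network phi v h y r0.
  by apply: is_derive_eq; rewrite /drisk_integrand /GRing.scale/=; ring.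
have d1E (h y : R) : partial1of2 f h y =
    drisk_integrand alpha r%:E (h *: v + phi) v y.
  by rewrite /partial1of2 derive1E; apply: derive_val.
have [B dB] := drisk_integrand_bound H alpha K `|v|.
have B0 : 0 <= B.
  apply: (le_trans (normr_ge0 _) (dB r%:E (0 *: v + phi) v 0 _ _ _ _)) => //.
  - by apply: line_le; lra.
  - exact: normr_coord_le.
  - by rewrite lexx ler01.
have mN h : measurable_fun setT (fun y => network r%:E (h *: v + phi) y).
  exact: measurable_network.
have fint h : `]-1, 1[%classic h ->
    (@lebesgue_measure R).-integrable `[0, 1] (EFin \o f h).
  rewrite /= in_itv/= => h1.
  apply: (@integrable_itv_bounded _ _ _
      ((K + H%:R * (K * (2 * K + 1)) + `|alpha|) ^+ 2)).
    by apply: measurable_funTS; apply: measurable_funX; exact: measurable_funB.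
  move=> y y01; rewrite normrX ler_pXn2r ?nnegrE//.
    apply: le_trans (ler_normB _ _) _; rewrite lerD2r.
    by apply: network_bound => //; exact: line_le.
  rewrite addr_ge0//; apply: le_trans (normr_ge0 _) _; last first.
    apply: (@network_bound _ _ _ r1E (h *: v + phi) K y) => //.
    exact: line_le.
pose F h := \int[lebesgue_measure]_(y in `[0, 1]) f h y.
have -> : drisk alpha r%:E phi v =
    \int[lebesgue_measure]_(y in `[0, 1]) partial1of2 f 0 y.
  by apply: eq_Rintegral => y _; rewrite d1E scale0r add0r.
apply/cvg_lim => //.
rewrite (_ : (fun x => _) = fun x : R => x^-1 *: (F (x + 0) - F 0)); last first.
  by apply/funext => x; rewrite /F /f /= /risk !addr0 scale0r add0r.
have I0 : `]-1, 1[%classic (0 : R) by rewrite /= in_itv/=; lra.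
have f_derivable (x y : R) : `]-1, 1[%classic x -> `[0, 1]%classic y ->
    derivable (f ^~ y) x 1 by move=> _ _; have [] := df x y.
have intB : (@lebesgue_measure R).-integrable `[0, 1] (EFin \o cst B).
  apply: (@integrable_itv_bounded _ _ _ B) => // y _.
  by rewrite /= ger0_norm.
have dfB (x y : R) : `]-1, 1[%classic x -> `[0, 1]%classic y ->
    `|partial1of2 f x y| <= cst B y.
  rewrite /= !in_itv/= => x1 y1; rewrite d1E; apply: dB => //.
    exact: line_le.
  exact: normr_coord_le.
exact: (@cvg_differentiation_under_integral R _ _ lebesgue_measure f _
  (measurable_itv _) _ _ _ I0 fint f_derivable _ (fun=> B0) intB dfB).
Qed.

(** * Passage to the limit in [r] and identification of [calG] *)

Lemma cvg_drisk_integrand (R : realType) (H : nat) (alpha : R)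
    (phi v : 'rV[R]_(3 * H).+1) (y : R) :
  (fun n => drisk_integrand alpha (n.+1%:R)%:E phi v y) @ \oo -->
  drisk_integrand alpha +oo%E phi v y.
Proof.
have cS x := @cvg_sigma R x; have cD x := @cvg_dsigma R x.
apply: cvgM.
  apply: cvgM; first exact: cvg_cst.
  apply: cvgB; last exact: cvg_cst.
  apply: cvgD; first exact: cvg_cst.
  apply: cvg_big => [|j _]; first exact: add_continuous.
  by apply: cvgM; [exact: cvg_cst|exact: cS].
apply: cvgD; first exact: cvg_cst.
apply: cvg_big => [|j _]; first exact: add_continuous.
apply: cvgD; apply: cvgM; try exact: cvg_cst.
  exact: cS.
by apply: cvgM; [exact: cD|exact: cvg_cst].
Qed.

Lemma integrable_drisk_integrand (R : realType) (H : nat) (alpha : R) r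
    (phi v : 'rV[R]_(3 * H).+1) : (1 <= r)%E ->
  (@lebesgue_measure R).-integrable `[0, 1]
    (EFin \o drisk_integrand alpha r phi v).
Proof.
move=> r1; have [B dB] := drisk_integrand_bound H alpha `|phi| `|v|.
apply: (@integrable_itv_bounded _ _ _ B).
  by apply: measurable_funTS; exact: measurable_drisk_integrand.
by move=> y y01; apply: dB => // i; exact: normr_coord_le.
Qed.

Lemma cvg_drisk (R : realType) (H : nat) (alpha : R)
    (phi v : 'rV[R]_(3 * H).+1) :
  (fun n => drisk alpha (n.+1%:R)%:E phi v) @ \oo --> drisk alpha +oo%E phi v.
Proof.
have [B dB] := drisk_integrand_bound H alpha `|phi| `|v|.
have r1 n : (1 <= (n.+1%:R : R)%:E)%E by rewrite lee_fin ler1n.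
have ry : (1 <= +oo :> \bar R)%E by rewrite leey.
apply: fine_cvg.
rewrite fineK; last first.
  apply: integrable_fin_num => //.
  exact: (integrable_drisk_integrand _ _ _ ry).
have idr (r : \bar R) : (1 <= r)%E -> measurable_fun (`[0, 1] : set R)
    (EFin \o drisk_integrand alpha r phi v).
  move=> rr; apply/measurable_EFinP/measurable_funTS.
  exact: measurable_drisk_integrand.
have [//|||||//] := @dominated_convergence _ _ _ (@lebesgue_measure R) `[0, 1]
  (measurable_itv _) (fun n => EFin \o drisk_integrand alpha (n.+1%:R)%:E phi v)
  (EFin \o drisk_integrand alpha +oo%E phi v) (cst B%:E).
- by move=> n; exact: idr.
- exact: idr.
- apply: aeW => y _; apply: cvg_EFin; first exact: nearW.
  exact: cvg_drisk_integrand.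
- apply: (@integrable_itv_bounded _ _ _ `|B| (cst B)) => //.
- apply: aeW => y n; rewrite /= in_itv/= => y01; rewrite lee_fin.
  by apply: dB => // i; exact: normr_coord_le.
Qed.

(** There are finitely many entries, so their neighbourhoods of infinity can be intersected. *)
Lemma cvg_row (R : realType) (n : nat) (u : nat -> 'rV[R]_n.+1)
    (l : 'rV[R]_n.+1) :
  (forall i, (fun k => u k 0 i) @ \oo --> l 0 i) -> u @ \oo --> l.
Proof.
move=> ul; apply/cvg_mx_entourageP => A entA.
apply: filterS (_ : \forall k \near \oo, forall i, (l 0 i, u k 0 i) \in A).
  by move=> k h i j; rewrite ord1.
apply: filter_forall => i.
have /cvg_app_entourageP/(_ A entA) := ul i.
by apply: filterS => k; rewrite inE.
Qed.

(** Every entry of the gradients converges at every [phi], so the convergence premise in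
    [limit_gradient] always holds and [calG] has an explicit integral formula. *)
Lemma limit_gradientE (R : realType) (H : nat) (alpha : R)
    (calG : 'rV[R]_(3 * H).+1 -> 'rV[R]_(3 * H).+1) :
  limit_gradient alpha calG -> forall phi i,
  calG phi 0 i = drisk alpha +oo%E phi (delta_mx 0 i).
Proof.
move=> calG_lim phi i.
have cG : (fun r : nat => gradient (risk alpha (r.+1%:R)%:E) phi) @ \oo -->
    \row_i drisk alpha +oo%E phi (delta_mx 0 i).
  apply: cvg_row => j; rewrite mxE.
  under eq_fun do rewrite mxE derive_risk ?ler1n//.
  exact: cvg_drisk.
rewrite calG_lim; last by apply/cvg_ex; eexists; exact: cG.
by rewrite (cvg_lim _ cG)// mxE.
Qed.

(** * Linearity in the direction, and the Euler-type identity for the ReLU risk *)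

Section Linearity.
Variables (R : realType) (H : nat) (alpha : R) (r : \bar R).
Hypothesis r1 : (1 <= r)%E.
Implicit Types phi v w : 'rV[R]_(3 * H).+1.

Lemma dnetwork_linear phi v w (a y : R) :
  dnetwork r phi (a *: v + w) y = a * dnetwork r phi v y + dnetwork r phi w y.
Proof.
rewrite /dnetwork !mxE mulrDr mulr_sumr addrACA; congr (_ + _).
rewrite -big_split; apply: eq_bigr => j _ /=.
by rewrite preact_line !mxE; ring.
Qed.

Lemma drisk_linear phi v w (a : R) :
  drisk alpha r phi (a *: v + w) =
  a * drisk alpha r phi v + drisk alpha r phi w.
Proof.
have iv := integrable_drisk_integrand alpha phi v r1.
have iw := integrable_drisk_integrand alpha phi w r1.
rewrite /drisk -RintegralZl// -RintegralD//; last first.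
  exact: (integrableZl _ a iv).
by apply: eq_Rintegral => y _; rewrite /drisk_integrand dnetwork_linear; ring.
Qed.

Lemma drisk_sum_delta phi v :
  drisk alpha r phi v = \sum_i v 0 i * drisk alpha r phi (delta_mx 0 i).
Proof.
have drisk0 : drisk alpha r phi 0 = 0.
  by have := drisk_linear phi 0 0 (-1); rewrite scaler0 addr0; lra.
rewrite {1}[v]row_sum_delta.
(* The induction runs over an arbitrary list of indices; [drisk0] settles the empty list. *)
elim: (index_enum _) => [|i s IH]; first by rewrite !big_nil.
by rewrite !big_cons drisk_linear IH.
Qed.
End Linearity.

Lemma inord_neq_ord_max (n k : nat) : (k < n)%N ->
  (inord k == ord_max :> 'I_n.+1) = false.
Proof.
by move=> kn; apply/eqP => /(congr1 val); rewrite /= inordK ?ltnS 1?ltnW//; lia.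
Qed.

(* With ReLU, [dsigma +oo x * x = sigma +oo x]: in the direction [phi] itself
   the inner and the outer weights each contribute the whole hidden layer. *)
Lemma drisk_euler (R : realType) (H : nat) (alpha : R)
    (phi : 'rV[R]_(3 * H).+1) :
  \sum_i 2 * phi 0 i * drisk alpha +oo%E phi (delta_mx 0 i) +
    2 * (phi 0 ord_max - 2 * alpha) *
      drisk alpha +oo%E phi (delta_mx 0 ord_max) =
  8 * risk alpha +oo%E phi.
Proof.
have ry : (1 <= +oo :> \bar R)%E by rewrite leey.
(* The hidden layer counts twice but the outer bias only once, hence the subtracted copy. *)
have dphi y : dnetwork +oo%E phi phi y =
    2 * network +oo%E phi y - phi 0 ord_max.
  have hidden : \sum_(j < H) (phi 0 (inord (2 * H + j)) *
        sigma +oo%E (preact phi j y) + phi 0 (inord (2 * H + j)) *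
        (dsigma +oo%E (preact phi j y) * preact phi j y)) =
      2 * \sum_(j < H) phi 0 (inord (2 * H + j)) * sigma +oo%E (preact phi j y).
    rewrite mulr_sumr; apply: eq_bigr => j _; rewrite /sigma /dsigma.
    by case: (leP (preact phi j y) 0) => _ /=; ring.
  rewrite /dnetwork hidden /network.
  under [in RHS]eq_bigr do rewrite -/(preact phi _ y).
  ring.
(* The neuron indices all lie below [3 * H], so the last basis vector moves the outer bias alone. *)
have dlast y : dnetwork +oo%E phi (delta_mx 0 ord_max) y = 1.
  rewrite /dnetwork mxE !eqxx big1 ?addr0// => j _.
  have jH := ltn_ord j.
  by rewrite /preact !mxE !inord_neq_ord_max ?andbF /=; [ring|lia..].
pose c := 2 * (phi 0 ord_max - 2 * alpha).
(* This is the gradient of [lyapunov] at [phi], arranged in the shape [a *: v + w] of the linearity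
   lemmas. The derivative of the network along it is [4 * (network - alpha)]: the shift [2 * alpha]
   is what cancels the outer bias. *)
pose u := 1 *: phi + (c *: delta_mx 0 ord_max + phi).
have du y : drisk_integrand alpha +oo%E phi u y =
    8 * (network +oo%E phi y - alpha) ^+ 2.
  by rewrite /drisk_integrand !dnetwork_linear dphi dlast /c; ring.
have -> : risk alpha +oo%E phi = 8^-1 * drisk alpha +oo%E phi u.
  rewrite /drisk -RintegralZl//; last exact: integrable_drisk_integrand.
  by apply: eq_Rintegral => y _; rewrite du mulrA mulVf ?mul1r.
rewrite mulrA divff// mul1r /u !drisk_linear// -/c.
under eq_bigr do rewrite -mulrA.
by rewrite -mulr_sumr -(drisk_sum_delta alpha ry phi phi); ring.
Qed.

(** * Measurability of the limit gradient in the parameters *)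

(** Tonelli makes the partial integral of a nonnegative jointly measurable function measurable; it
    is applied to positive and negative parts. Continuity in [phi] is thereby avoided. *)
Lemma measurable_drisk (R : realType) (H : nat) d (X : measurableType d)
    (alpha : R) (r : \bar R) (phi : X -> 'rV[R]_(3 * H).+1)
    (v : 'rV[R]_(3 * H).+1) : (1 <= r)%E ->
  (forall i, measurable_fun setT (fun x => phi x 0 i)) ->
  measurable_fun setT (fun x => drisk alpha r (phi x) v).
Proof.
move=> r1 mphi.
(* The indicator moves the domain [[0, 1]] into the integrand, since [fubini_F] integrates over the
   whole line. *)
pose k (z : X * R) : \bar R :=
  (drisk_integrand alpha r (phi z.1) v z.2 * \1_(`[0, 1] : set R) z.2)%:E.
have mk : measurable_fun setT k.
  apply/measurable_EFinP; apply: measurable_funM.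
    apply: measurable_drisk_integrand => // i.
    exact: (measurableT_comp (mphi i) measurable_fst).
  by apply: measurableT_comp => //; exact: measurable_indic.
have -> : (fun x => drisk alpha r (phi x) v) = fun x =>
    fine (fubini_F lebesgue_measure k^\+ x -
      fubini_F lebesgue_measure k^\- x)%E.
  apply/funext => x; rewrite /drisk /Rintegral integral_mkcond integralE.
  rewrite /fubini_F; congr (fine (_ - _)); apply: eq_integral => y _.
  - by rewrite !funeposE /k patchE indicE; case: ifP; rewrite ?mulr1 ?mulr0.
  - by rewrite !funenegE /k patchE indicE; case: ifP; rewrite ?mulr1 ?mulr0.
apply: measurableT_comp => //; apply: emeasurable_funB.
  by apply: measurable_fun_fubini_tonelli_F => //; exact: measurable_funepos.
by apply: measurable_fun_fubini_tonelli_F => //; exact: measurable_funeneg.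
Qed.

(** * Squares of primitives of bounded measurable functions *)

(* Subdividing [0, t] into n pieces gives [|W t - W 0| <= C t^2 / n]. *)
Lemma quadratic_increment_cst (R : realType) (T C : R) (W : R -> R) :
  (forall s t, 0 <= s -> s <= t -> t <= T ->
    `|W t - W s| <= C * (t - s) ^+ 2) ->
  forall t, 0 <= t <= T -> W t = W 0.
Proof.
move=> WC t /andP[t0 tT]; apply/eqP; rewrite -subr_eq0 -normr_le0.
have step n k : (k <= n.+1)%N ->
    `|W (k%:R * (t / n.+1%:R)) - W 0| <= k%:R * (C * (t / n.+1%:R) ^+ 2).
  elim: k => [|k IH] kn; first by rewrite !mul0r subrr normr0.
  have n0 : 0 < n.+1%:R :> R by rewrite ltr0n.
  have d0 : 0 <= t / n.+1%:R by rewrite divr_ge0// ltW.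
  rewrite -[W _ - W 0](subrKA (W (k%:R * (t / n.+1%:R)))).
  apply: le_trans (ler_normD _ _) _.
  rewrite [in leRHS]mulrSr [in leRHS]mulrDl mul1r addrC.
  apply: lerD; first by apply: IH; exact: ltnW.
  have dE : k.+1%:R * (t / n.+1%:R) - k%:R * (t / n.+1%:R) = t / n.+1%:R.
    by rewrite -mulrBl -natrB ?leqnSn// subSnn mul1r.
  rewrite -[X in C * X ^+ 2]dE; apply: WC.
  - by rewrite mulr_ge0.
  - by rewrite -subr_ge0 dE.
  - apply: le_trans tT; rewrite mulrCA ler_piMr//.
    by rewrite ler_pdivrMr// mul1r ler_nat.
have bound n : `|W t - W 0| <= C * t ^+ 2 * n.+1%:R^-1.
  have := step n n.+1 (leqnn _); rewrite mulrCA divff ?pnatr_eq0// mulr1.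
  move/le_trans; apply; rewrite le_eqVlt; apply/orP; left; apply/eqP.
  by field; rewrite addrC -mulrSr pnatr_eq0.
have lim0 : (fun n => C * t ^+ 2 * n.+1%:R^-1) @ \oo --> (0 : R).
  rewrite -(mulr0 (C * t ^+ 2)); apply: cvgM; first exact: cvg_cst.
  exact: cvg_harmonic.
rewrite -[leRHS](cvg_lim _ lim0)//; apply: limr_ge; first exact: cvgP lim0.
by apply: nearW => n; exact: bound.
Qed.

Lemma Rintegral_itv_norm_le (R : realType) (a b B : R) (f : R -> R) :
  a <= b -> measurable_fun `[a, b] f ->
  (forall x, a <= x <= b -> `|f x| <= B) ->
  `|\int[lebesgue_measure]_(x in `[a, b]) f x| <= B * (b - a).
Proof.
move=> ab mf fB.
have muab : fine ((@lebesgue_measure R) `[a, b]%classic) = b - a.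
  rewrite lebesgue_measure_itv/= lte_fin; case: ltP => // ba.
  have -> : a = b by apply/le_anti/andP.
  by rewrite subrr.
have intf := integrable_itv_bounded mf fB.
have intn : (@lebesgue_measure R).-integrable `[a, b]
    (EFin \o (fun x => `|f x|)).
  apply: (@integrable_itv_bounded _ _ _ B).
    exact: measurableT_comp.
  by move=> x ab'; rewrite normr_id fB.
have intB : (@lebesgue_measure R).-integrable `[a, b] (EFin \o cst B).
  by apply: (@integrable_itv_bounded _ _ _ `|B|).
apply: (le_trans (le_normr_Rintegral _ intf)) => //.
rewrite -muab -Rintegral_cst//; exact: le_Rintegral.
Qed.

Lemma Rintegral_sum (R : realType) d (X : measurableType d)
    (mu : {measure set X -> \bar R}) (D : set X) (I : Type) (s : seq I)
    (f : I -> X -> R) : measurable D ->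
  (forall i, mu.-integrable D (EFin \o f i)) ->
  \int[mu]_(x in D) (\sum_(i <- s) f i x) =
  \sum_(i <- s) \int[mu]_(x in D) f i x.
Proof.
move=> mD intf; elim: s => [|i s IH].
  under eq_Rintegral do rewrite big_nil.
  by rewrite big_nil Rintegral_cst// mul0r.
under eq_Rintegral do rewrite big_cons.
rewrite RintegralD// ?IH ?big_cons//.
rewrite (_ : _ \o _ = fun x => (\sum_(j <- s) (f j x)%:E)%E); last first.
  by apply/funext => x; rewrite /= sumEFin.
by apply: integrable_sum => // j _; exact: intf.
Qed.

(** An integrated chain rule that never differentiates [F]. It serves with [p = 0] for each
    coordinate and with [p = 2 * alpha] for the outer bias, matching the squares in [lyapunov]. *)
Lemma sqr_primitive (R : realType) (T M p : R) (F g : R -> R) :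
  measurable_fun `[0, T] g -> measurable_fun `[0, T] F ->
  (forall s, 0 <= s <= T -> `|g s| <= M) ->
  (forall t, 0 <= t <= T ->
    F t = F 0 - \int[lebesgue_measure]_(s in `[0, t]) g s) ->
  forall t, 0 <= t <= T -> (F t - p) ^+ 2 = (F 0 - p) ^+ 2 -
    2 * \int[lebesgue_measure]_(s in `[0, t]) ((F s - p) * g s).
Proof.
move=> mg mF gM FE.
have sub (a b : R) : 0 <= a -> b <= T -> `[a, b] `<=` `[0, T].
  by move=> a0 bT x /=; rewrite !in_itv/= => /andP[ax xb]; lra.
have split (h : R -> R) (B s t : R) : 0 <= s -> s <= t -> t <= T ->
    measurable_fun `[0, T] h -> (forall x, 0 <= x <= T -> `|h x| <= B) ->
    \int[lebesgue_measure]_(x in `[0, t]) h x -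
      \int[lebesgue_measure]_(x in `[0, s]) h x =
    \int[lebesgue_measure]_(x in `[s, t]) h x.
  move=> s0 st tT mh hB.
  have inth (a b : R) : 0 <= a -> b <= T ->
      (@lebesgue_measure R).-integrable `[a, b] (EFin \o h).
    move=> a0 bT; apply: (@integrable_itv_bounded _ _ _ B).
      exact: measurable_funS (sub _ _ a0 bT) mh.
    by move=> x axb; apply: hB; lra.
  (* A difference of integrals lives on the half-open []s, t]]; the added endpoint is a null set. *)
  rewrite -Rintegral_itv_obnd_cbnd; last first.
    apply: (integrableS _ _ _ (inth s t s0 tT)) => //.
    exact: subset_itv_oc_cc.
  by apply: Rintegral_itvB; rewrite ?bnd_simp//; exact: inth.
have incF (s t : R) : 0 <= s -> s <= t -> t <= T ->
    F t - F s = - \int[lebesgue_measure]_(x in `[s, t]) g x.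
  move=> s0 st tT; rewrite -(split g M)// FE; last by lra.
  by rewrite (FE s); [ring|lra].
have incF_le (s t : R) : 0 <= s -> s <= t -> t <= T ->
    `|F t - F s| <= M * (t - s).
  move=> s0 st tT; rewrite incF// normrN; apply: Rintegral_itv_norm_le => //.
    exact: measurable_funS (sub _ _ s0 tT) mg.
  by move=> x sxt; apply: gM; lra.
have FB x : 0 <= x <= T -> `|F x - p| <= `|F 0 - p| + M * T.
  move=> /andP[x0 xT]; have -> : F x - p = F 0 - p + (F x - F 0) by ring.
  apply: le_trans (ler_normD _ _) _; rewrite lerD2l.
  apply: le_trans (incF_le _ _ (lexx 0) x0 xT) _.
  have M0 : 0 <= M by apply: le_trans (normr_ge0 (g x)) (gM _ _); lra.
  by rewrite ler_wpM2l//; lra.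
have mFg : measurable_fun `[0, T] (fun s => (F s - p) * g s).
  by apply: measurable_funM => //; exact: measurable_funB.
pose W t := (F t - p) ^+ 2 +
  2 * \int[lebesgue_measure]_(s in `[0, t]) ((F s - p) * g s).
suff WE : forall t, 0 <= t <= T -> W t = W 0.
  move=> t tT; have := WE t tT; rewrite /W set_itv1 Rintegral_set1; lra.
(* In the integrand below, the first factor is a sum of two increments of [F], each at most
   [M * (t - s)]; [g] contributes the other [M], and the length of [[s, t]] the second power. *)
apply: (@quadratic_increment_cst _ _ (2 * M * M)) => s t s0 st tT.
have subst := sub _ _ s0 tT.
(* The difference of squares factors as [F t - F s], that is minus the integral of [g], times the
   constant [F t - p + (F s - p)], which is then moved under the integral. *)
have -> : W t - W s = \int[lebesgue_measure]_(x in `[s, t])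
    ((2 * (F x - p) - (F t - p + (F s - p))) * g x).
  have intg : (@lebesgue_measure R).-integrable `[s, t] (EFin \o g).
    apply: (@integrable_itv_bounded _ _ _ M); first exact: measurable_funS mg.
    by move=> x sxt; apply: gM; lra.
  have intFg : (@lebesgue_measure R).-integrable `[s, t]
      (EFin \o (fun x => (F x - p) * g x)).
    apply: (@integrable_itv_bounded _ _ _ ((`|F 0 - p| + M * T) * M)).
      exact: measurable_funS mFg.
    by move=> x sxt; rewrite normrM ler_pM ?FB ?gM//; lra.
  under eq_Rintegral do rewrite mulrBl -mulrA.
  rewrite RintegralB// ?RintegralZl//; last 2 first.
  - exact: (integrableZl _ 2 intFg).
  - exact: (integrableZl _ (F t - p + (F s - p)) intg).
  rewrite -(split (fun x => (F x - p) * g x) ((`|F 0 - p| + M * T) * M))//;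
    last by move=> x xT; rewrite normrM ler_pM ?FB ?gM.
  have := incF _ _ s0 st tT; rewrite /W.
  move: (\int[lebesgue_measure]_(x in `[s, t]) g x) => J FJ.
  have -> : J = F s - F t by lra.
  ring.
rewrite expr2 mulrA; apply: Rintegral_itv_norm_le => //.
  apply: measurable_funM; last exact: measurable_funS mg.
  apply: measurable_funB => //; apply: measurable_funM => //.
  by apply: measurable_funB => //; exact: measurable_funS mF.
move=> x /andP[sx xt]; rewrite normrM (_ : 2 * M * M * _ = 2 * M * (t - s) * M);
  last by ring.
apply: ler_pM => //; last by apply: gM; lra.
have x0 : 0 <= x by lra.
have xT : x <= T by lra.
have := incF_le _ _ s0 sx xT; have := incF_le _ _ x0 xt tT.
rewrite !ler_norml => /andP[? ?] /andP[? ?].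
have M0 : 0 <= M by apply: le_trans (normr_ge0 (g x)) (gM _ _); lra.
by apply/andP; split; nra.
Qed.

(** * The Lyapunov identity along the trajectory *)

Theorem lemma3p2 (R : realType) (H : nat) (H_gt0 : (0 < H)%N) (alpha : R)
    (calG : 'rV[R]_(3 * H).+1 -> 'rV[R]_(3 * H).+1)
    (calG_lim : limit_gradient alpha calG)
    (T : R) (T_gt0 : 0 < T)
    (Theta : R -> 'rV[R]_(3 * H).+1)
    (Theta_cont : {within `[0, T], continuous Theta})
    (Theta_flow : forall t : R, 0 <= t <= T ->
      Theta t = Theta 0 - row_integral `[0, t] (fun s => calG (Theta s))) :
  forall t : R, 0 <= t <= T ->
    lyapunov alpha (Theta t) = lyapunov alpha (Theta 0) -
      8 * \int[lebesgue_measure]_(s in `[0, t]) risk alpha +oo%E (Theta s).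
Proof.
have ry : (1 <= +oo :> \bar R)%E by rewrite leey.
pose mu := @lebesgue_measure R.
pose g i s := drisk alpha +oo%E (Theta s) (delta_mx 0 i).
have coordC i : {within `[0, T], continuous (fun s => Theta s 0 i)}.
  move=> s.
  exact: (cvg_comp _ _ (Theta_cont s) (@coord_continuous _ _ _ 0 i (Theta s))).
have [K ThetaK] : exists K : R, forall s : R, 0 <= s <= T ->
    forall i, `|Theta s 0 i| <= K.
  have nC : {within `[0, T], continuous (fun s => `|Theta s|)}.
    move=> s.
    exact: (cvg_comp _ _ (Theta_cont s) (@norm_continuous _ _ (Theta s))).
  have [c _ cmax] := EVT_max (ltW T_gt0) nC.
  exists `|Theta c| => s s0T i; apply: le_trans (normr_coord_le _ _ _) _.
  by apply: cmax; rewrite in_itv.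
have mTheta i : measurable_fun (`[0, T] : set R) (fun s => Theta s 0 i).
  by apply: subspace_continuous_measurable_fun => //; exact: coordC.
have mg i : measurable_fun (`[0, T] : set R) (g i).
  (* [Theta] is controlled only on [[0, T]]; extending it by 0 gives the measurability on the whole
     line that [measurable_drisk] asks for. *)
  pose Theta' s := if s \in `[0, T]%classic then Theta s else 0.
  apply: (eq_measurable_fun (fun s =>
      drisk alpha +oo%E (Theta' s) (delta_mx 0 i))).
    by move=> s sT; rewrite /Theta' sT.
  apply: measurable_funTS; apply: measurable_drisk => // j.
  have -> : (fun s => Theta' s 0 j) = (fun s => Theta s 0 j) \_ `[0, T].
    by apply/funext => s; rewrite patchE /Theta'; case: ifP; rewrite ?mxE.
  exact: (iffLR (measurable_restrictT _ (measurable_itv _)) (mTheta j)).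
have [M gM] : exists M : R, forall (s : R) i, 0 <= s <= T -> `|g i s| <= M.
  (* [K] bounds the trajectory, and 1 bounds the entries of the basis vectors. *)
  have [B dB] := drisk_integrand_bound H alpha K 1.
  exists B => s i s0T; rewrite -[B]mulr1 -[X in B * X](subr0 1).
  apply: Rintegral_itv_norm_le => //.
    by apply: measurable_funTS; exact: measurable_drisk_integrand.
  move=> y y01; apply: dB => //; first exact: ThetaK.
  by move=> j; rewrite mxE; case: (_ && _); rewrite ?normr1 ?normr0.
have flow i t : 0 <= t <= T ->
    Theta t 0 i = Theta 0 0 i - \int[mu]_(s in `[0, t]) g i s.
  move=> t0T; rewrite [in LHS]Theta_flow// !mxE; congr (_ - _).
  by apply: eq_Rintegral => s _; rewrite (limit_gradientE calG_lim).
have sqrE p i := sqr_primitive p (mg i) (mTheta i) (gM^~ i) (flow i).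
(* The term [- 0] is kept so that [sqrE] with [p = 0] matches syntactically. *)
have lyapE v : lyapunov alpha v =
    \sum_i (v 0 i - 0) ^+ 2 + (v 0 ord_max - 2 * alpha) ^+ 2.
  rewrite /lyapunov /euclidean_norm sqr_sqrtr; last first.
    by apply: sumr_ge0 => i _; exact: sqr_ge0.
  by congr (_ + _); apply: eq_bigr => i _; rewrite subr0.
move=> t t0T.
have intFg p i : mu.-integrable `[0, t]
    (EFin \o (fun s => (Theta s 0 i - p) * g i s)).
  have subT : `[0, t]%classic `<=` `[0, T]%classic.
    by move=> x /=; rewrite !in_itv/=; lra.
  apply: (@integrable_itv_bounded _ _ _ ((K + `|p|) * M)).
    apply: measurable_funM; last exact: measurable_funS (mg i).
    by apply: measurable_funB => //; exact: measurable_funS (mTheta i).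
  move=> s st; have sT : 0 <= s <= T by lra.
  rewrite normrM ler_pM ?gM//.
  by apply: le_trans (ler_normB _ _) _; rewrite lerD2r ThetaK.
(* Half the pairing of the gradient of [lyapunov] with [calG] along the trajectory, hence 4 times
   the risk by [drisk_euler]; the factor 2 in [sqrE] then yields 8. *)
pose k s := \sum_i (Theta s 0 i - 0) * g i s +
  (Theta s 0 ord_max - 2 * alpha) * g ord_max s.
have riskE s : risk alpha +oo%E (Theta s) = 4^-1 * k s.
  have kE : k s = \sum_i Theta s 0 i * g i s +
      (Theta s 0 ord_max - 2 * alpha) * g ord_max s.
    by congr (_ + _); apply: eq_bigr => i _; rewrite subr0.
  have : 2 * k s = 8 * risk alpha +oo%E (Theta s).
    rewrite -drisk_euler kE mulrDr mulr_sumr mulrA; congr (_ + _).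
    by apply: eq_bigr => i _; rewrite mulrA.
  lra.
have sumint : mu.-integrable `[0, t]
    (EFin \o (fun s => \sum_i (Theta s 0 i - 0) * g i s)).
  rewrite (_ : _ \o _ = fun s => (\sum_i ((Theta s 0 i - 0) * g i s)%:E)%E).
    by apply: integrable_sum => // i _; exact: intFg.
  by apply/funext => s; rewrite /= sumEFin.
have kint : \int[mu]_(s in `[0, t]) k s =
    \sum_i \int[mu]_(s in `[0, t]) ((Theta s 0 i - 0) * g i s) +
    \int[mu]_(s in `[0, t]) ((Theta s 0 ord_max - 2 * alpha) * g ord_max s).
  by rewrite RintegralD ?Rintegral_sum//; move=> i; exact: intFg.
have intk : mu.-integrable `[0, t] (EFin \o k).
  exact: (integrableD _ sumint (intFg (2 * alpha) ord_max)).
under eq_Rintegral do rewrite riskE.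
rewrite RintegralZl// kint !lyapE (sqrE _ _ _ t0T).
under eq_bigr do rewrite (sqrE _ _ _ t0T).
by rewrite sumrB -mulr_sumr; lra.
Qed.
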